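(* Let $(\Omega,\mathfrak S,\mathbb P)$ be a probability space with a group of $\mathbb P$-preserving measurable bijections $(\theta_x)_{x\in\mathbb Z^2}$, and $Y=(Y_x)_{x\in\mathbb Z^2}$ i.i.d. $\mathrm{Exp}(1)$ random variables on $\Omega$ with $Y_x(\omega)=Y_0(\theta_x\omega)$. Let $B^\alpha$ be the Busemann function in the characteristic direction $\xi(\alpha)$. The following hold for each $0<\alpha<1$. (i) The characteristic direction $\xi(\alpha)$ and the vector $h(B^\alpha)$ are dual to each other in the sense that $$g_{\rm pl}(h(B^\alpha))=g_{\rm pp}(\xi(\alpha))+h(B^\alpha)\cdot\xi(\alpha).$$ (ii) We have the identities $$g_{\rm pp}(\xi(\alpha))=-h(B^\alpha)\cdot\xi(\alpha)=\max_{i=1,2}\bigl[Y_0(\omega)-B^\alpha_{0,e_i}(\omega)-h(B^\alpha)\cdot\xi(\alpha)\bigr]\qquad\mathbb P\text{-almost surely.}$$ In other words, $B^\alpha$ is a minimizer, without the essential supremum, in the variational formula $$g_{\rm pp}(\xi)=\inf_{B\in\mathcal K}\ \mathbb P\text{-}\mathrm{ess\,sup}\ \max_{i=1,2}\{Y_0-B_{0,e_i}-h(B)\cdot\xi\}$$ at $\xi=\xi(\alpha)$.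
   Context: $e_1=(1,0)$, $e_2=(0,1)$. $\xi(\alpha)=\Bigl(\frac{(1-\alpha)^2}{(1-\alpha)^2+\alpha^2},\frac{\alpha^2}{(1-\alpha)^2+\alpha^2}\Bigr)$. Last-passage values: $G_{x,y}=\max\sum_{k=0}^{|y-x|_1}Y_{x_k}$ over up-right paths from $x$ to $y$ with increments in $\{e_1,e_2\}$. Shape functions: $g_{\rm pp}(\xi)=\lim_N N^{-1}G_{0,\lfloor N\xi\rfloor}=(\sqrt{\xi_1}+\sqrt{\xi_2})^2$ for $\xi\in\mathbb R_{\ge0}^2$, and $g_{\rm pl}(h)=\lim_n n^{-1}\max_{x_{0,n}:x_0=0}\{\sum_{k=0}^{n-1}Y_{x_k}+h\cdot x_n\}$ for $h\in\mathbb R^2$ (maximum over $n$-step paths from $0$ with increments in $\{e_1,e_2\}$). A stationary cocycle is a measurable $B:\Omega\times\mathbb Z^2\times\mathbb Z^2\to\mathbb R$, written $B_{x,y}(\omega)$, with, for $\mathbb P$-a.e. $\omega$ and all $x,y,z$: $B_{x+z,y+z}(\omega)=B_{x,y}(\theta_z\omega)$ and $B_{x,y}+B_{y,z}=B_{x,z}$. $\mathcal K$ is the set of stationary cocycles with $\mathbb E|B_{x,y}|<\infty$ for all $x,y$, and $h(B)=-(\mathbb E[B_{0,e_1}],\mathbb E[B_{0,e_2}])$. The Busemann function $B^\alpha\in\mathcal K$ is given by the $\mathbb P$-a.s. limits $B^\alpha_{x,y}=\lim_{n\to\infty}[G_{x,v_n}-G_{y,v_n}]$ for all $x,y\in\mathbb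 Z^2$ and any sequence $v_n\in\mathbb Z^2$ with $|v_n|_1\to\infty$, $v_n/|v_n|_1\to\xi(\alpha)$. (It is known that these limits exist a.s. simultaneously for all such sequences, that $B^\alpha_{x,x+e_1}\sim\mathrm{Exp}(1-\alpha)$ and $B^\alpha_{x,x+e_2}\sim\mathrm{Exp}(\alpha)$, rates indicated, and that $Y_x=B^\alpha_{x,x+e_1}\wedge B^\alpha_{x,x+e_2}$ a.s.) *)

(* Defs.v *)
From HB Require Import structures.
From mathcomp Require Import all_boot all_order all_algebra.
From mathcomp Require Import all_classical all_reals all_analysis ess_sup_inf.

Set Implicit Arguments.
Unset Strict Implicit.
Unset Printing Implicit Defensive.

Import Order.TTheory GRing.Theory Num.Theory.
Import numFieldNormedType.Exports.

Local Open Scope classical_set_scope.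
Local Open Scope ring_scope.

Notation site := (int * int)%type.

Definition e1 : site := (1, 0).
Definition e2 : site := (0, 1).

Definition norm1 (x : site) : nat := (`|x.1| + `|x.2|)%N.

(* A path from x is written x :: p, so that it makes size p steps. *)
Definition upright : rel site := fun x y => (y == x + e1) || (y == x + e2).

Section Deterministic.
Context {R : realType}.
Implicit Types (y : site -> R) (h xi : R * R).

Definition site_vec (x : site) : R * R := (x.1%:~R, x.2%:~R).

Definition dotp h xi : R := h.1 * xi.1 + h.2 * xi.2.

Definition floor_vec xi : site := (Num.floor xi.1, Num.floor xi.2).

(* The index set is finite, so that sup is a maximum, except that it is 0 when
   no up-right path goes from x to z. *)
Definition lpp y (x z : site) : R :=
  sup [set \sum_(u <- x :: p) y u | p in
        [set p : seq site | path upright x p /\ last x p = z]].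

(* belast 0 p lists x_0 = 0, ..., x_(n-1): the weight at x_n is not counted. *)
Definition pl_lpp y h (n : nat) : R :=
  sup [set \sum_(u <- belast 0 p) y u + dotp h (site_vec (last 0 p)) | p in
        [set p : seq site | path upright 0 p /\ size p = n]].

Definition char_dir (a : R) : R * R :=
  ((1 - a) ^+ 2 / ((1 - a) ^+ 2 + a ^+ 2), a ^+ 2 / ((1 - a) ^+ 2 + a ^+ 2)).

Definition in_direction (v : nat -> site) xi : Prop :=
  [/\ norm1 (v n) @[n --> \oo] --> \oo,
      (v n).1%:~R / (norm1 (v n))%:R @[n --> \oo] --> xi.1
    & (v n).2%:~R / (norm1 (v n))%:R @[n --> \oo] --> xi.2].

End Deterministic.

Section Probabilistic.
Context {d : measure_display} {Omega : measurableType d} {R : realType}.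
Variable P : probability Omega R.
Implicit Types (theta : site -> Omega -> Omega) (Y : site -> Omega -> R).
Implicit Types (B : Omega -> site -> site -> R) (h xi : R * R).

(* Each theta x is bijective, with inverse theta (- x). *)
Record pp_action theta : Prop := PPAction {
  ppa_id : forall w, theta 0 w = w;
  ppa_add : forall x z w, theta (x + z) w = theta x (theta z w);
  ppa_meas : forall x, measurable_fun setT (theta x);
  ppa_pres : forall x A, measurable A -> P (theta x @^-1` A) = P A }.

Definition exp_dist (rate : R) (X : Omega -> R) : Prop :=
  measurable_fun setT X /\
  forall A : set R, measurable A -> P (X @^-1` A) = exponential_prob rate A.

Definition mutual_indep Y : Prop :=
  forall (s : seq site) (A : site -> set R), uniq s ->
    (forall x, measurable (A x)) ->
    P [set w | forall x, x \in s -> A x (Y x w)] =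
    (\prod_(x <- s) P (Y x @^-1` A x))%E.

Definition iid_exp1 Y : Prop := mutual_indep Y /\ forall x, exp_dist 1 (Y x).

Definition as_cvg (u : nat -> Omega -> R) (c : R) : Prop :=
  {ae P, forall w, u n w @[n --> \oo] --> c}.

(* The constant almost sure limit, and 0 if there is none. *)
Definition as_lim (u : nat -> Omega -> R) : R := xget 0 [set c | as_cvg u c].

Definition pp_seq Y xi (N : nat) (w : Omega) : R :=
  N%:R^-1 * lpp (Y ^~ w) 0 (floor_vec (N%:R * xi.1, N%:R * xi.2)).

Definition gpp Y xi : R := as_lim (pp_seq Y xi).

Definition pl_seq Y h (n : nat) (w : Omega) : R :=
  n%:R^-1 * pl_lpp (Y ^~ w) h n.

Definition gpl Y h : R := as_lim (pl_seq Y h).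

Definition shape_theorem Y : Prop :=
  forall xi, 0 <= xi.1 -> 0 <= xi.2 ->
    as_cvg (pp_seq Y xi) ((Num.sqrt xi.1 + Num.sqrt xi.2) ^+ 2).

(* The space of integrable stationary cocycles.  As Z^2 is countable and
   discrete, joint measurability is measurability of each B_{x,z}. *)
Record cocycleK theta B : Prop := CocycleK {
  coc_meas : forall x z, measurable_fun setT (fun w => B w x z);
  coc_stat : {ae P, forall w, forall x y z, B w (x + z) (y + z) = B (theta z w) x y};
  coc_add : {ae P, forall w, forall x y z, B w x y + B w y z = B w x z};
  coc_int : forall x z, P.-integrable setT (fun w => (B w x z)%:E) }.

Definition hvec B : R * R :=
  (- fine 'E_P[fun w => B w 0%R e1]%E, - fine 'E_P[fun w => B w 0%R e2]%E).

Definition busemann theta Y (a : R) B : Prop :=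
  cocycleK theta B /\
  {ae P, forall w, forall v : nat -> site, in_direction v (char_dir a) ->
     forall x y,
       lpp (Y ^~ w) x (v n) - lpp (Y ^~ w) y (v n) @[n --> \oo] --> B w x y}.

Definition var_obj Y B xi (w : Omega) : R :=
  Num.max (Y 0 w - B w 0 e1 - dotp (hvec B) xi)
          (Y 0 w - B w 0 e2 - dotp (hvec B) xi).

Definition var_sup Y B xi : \bar R := ess_sup P (EFin \o var_obj Y B xi).

End Probabilistic.

(* Main.v *)
Require Import Defs.
From HB Require Import structures.
From mathcomp Require Import all_boot all_order all_algebra.
From mathcomp Require Import all_classical all_reals all_analysis ess_sup_inf.
From mathcomp Require Import measurable_realfun.
From mathcomp Require Import zify ring lra.

Set Implicit Arguments.
Unset Strict Implicit.
Unset Printing Implicit Defensive.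

Import Order.TTheory GRing.Theory Num.Theory.
Import numFieldNormedType.Exports.

Local Open Scope classical_set_scope.
Local Open Scope ring_scope.

(* With h = h(B) = (- 1/(1-a), - 1/a), Cauchy-Schwarz gives g_pp(xi) <= - h.xi, with
   equality at xi(a).  Rounding end points up to finitely many directions, the
   monotonicity of last-passage values makes the upper bound uniform, so that
   g_pl(h) <= 0; paths in the direction xi(a) give g_pl(h) >= 0.

   The recursion G_{0,v} = Y_0 + max (G_{e1,v}, G_{e2,v}) becomes
   Y_0 = min (B_{0,e1}, B_{0,e2}) as v goes to infinity in the direction xi(a).

   If Y_0 - B_{0,e_i} - h(B).xi <= c almost surely for a cocycle B, summing
   along paths gives G_{0,x} <= B_{0,x+e1} + (|x|_1 + 1) (c + h(B).xi) for all x.  At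
   x = floor (N xi), the right-hand side divided by N has expectation tending
   to c, and Fatou's lemma yields g_pp(xi) <= c. *)

(** * Last-passage values *)

Definition sle (x z : site) : Prop := x.1 <= z.1 /\ x.2 <= z.2.

Lemma upright_path_size (x : site) (p : seq site) :
  path upright x p -> (last x p).1 + (last x p).2 = x.1 + x.2 + (size p)%:Z.
Proof.
elim: p x => [|u p IH] x /=; first by lia.
by case/andP=> /orP[]/eqP-> /IH ->; case: x => x1 x2 /=; lia.
Qed.

Lemma upright_path_le (x : site) (p : seq site) :
  path upright x p -> sle x (last x p).
Proof.
rewrite /sle; elim: p x => [|u p IH] x /=; first by lia.
by case/andP=> /orP[]/eqP-> /IH; case: x => x1 x2 /=; lia.
Qed.

Lemma upright_path_exists (x z : site) : sle x z ->
  exists2 p, path upright x p & last x p = z.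
Proof.
move=> [h1 h2]; have [n nE] : exists n : nat, z.1 + z.2 - x.1 - x.2 = n%:Z.
  by exists (absz (z.1 + z.2 - x.1 - x.2)%R); lia.
elim: n x h1 h2 nE => [|n IH] [x1 x2] /= h1 h2 nE.
  by exists [::] => //=; case: z h1 h2 nE => z1 z2 /= *; congr (_, _); lia.
have [lt1|ge1] := ltP x1 z.1.
  have [||| p pp pE] := IH (x1 + 1, x2 + 0); rewrite /=; try lia.
  by exists ((x1 + 1, x2 + 0) :: p); rewrite //= /upright eqxx.
have [||| p pp pE] := IH (x1 + 0, x2 + 1); rewrite /=; try lia.
by exists ((x1 + 0, x2 + 1) :: p); rewrite //= /upright eqxx orbT.
Qed.

Section LastPassage.
Context {R : realType}.
Implicit Types (y : site -> R) (x z : site) (p : seq site).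

(** The passage value over all [n]-step paths from [x] with free end point. It shows that the index
    sets of [lpp] and [pl_lpp] are bounded, so that [sup] is an upper bound of them. *)
Fixpoint steps_bound y (x : site) (n : nat) : R :=
  if n is m.+1 then
    y x + Num.max (steps_bound y (x + e1) m) (steps_bound y (x + e2) m)
  else y x.

Lemma path_sum_le_bound y x p : path upright x p ->
  \sum_(u <- x :: p) y u <= steps_bound y x (size p).
Proof.
elim: p x => [|u p IH] x /=; first by rewrite big_seq1.
case/andP=> xu /IH {}IH; rewrite big_cons lerD2l.
by case/orP: xu IH => /eqP-> IH; rewrite le_max IH ?orbT.
Qed.

(** All up-right paths from [x] to [z] have the same number of steps. *)
Lemma lpp_has_ubound y x z : has_ubound
  [set \sum_(u <- x :: p) y u | p in
        [set p : seq site | path upright x p /\ last x p = z]].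
Proof.
exists (steps_bound y x (absz (z.1 + z.2 - x.1 - x.2)%R)) => _ [p [pp pE] <-].
have := upright_path_size pp; rewrite pE => sp.
have -> : (absz (z.1 + z.2 - x.1 - x.2)%R) = size p by lia.
exact: path_sum_le_bound.
Qed.

Lemma path_sum_le_lpp y x p : path upright x p ->
  \sum_(u <- x :: p) y u <= lpp y x (last x p).
Proof.
by move=> pp; apply: (ub_le_sup (lpp_has_ubound _ _ _)); exists p.
Qed.

Lemma lpp_le y x z (M : R) : sle x z ->
  (forall p, path upright x p -> last x p = z -> \sum_(u <- x :: p) y u <= M) ->
  lpp y x z <= M.
Proof.
move=> xz h; apply: ge_sup => [|_ [p [pp pE] <-]]; last exact: h.
have [p pp pE] := upright_path_exists xz.
by exists (\sum_(u <- x :: p) y u), p.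
Qed.

Lemma lpp_ge0 y x z : (forall u, 0 <= y u) -> sle x z -> 0 <= lpp y x z.
Proof.
move=> y0 /upright_path_exists[p pp <-].
by apply: le_trans (path_sum_le_lpp y pp); apply: sumr_ge0.
Qed.

Lemma lpp_monotone y x z z' : (forall u, 0 <= y u) -> sle x z -> sle z z' ->
  lpp y x z <= lpp y x z'.
Proof.
move=> y0 xz /upright_path_exists[q qq qE]; apply: lpp_le => // p pp pE.
have pq : path upright x (p ++ q) by rewrite cat_path pp pE.
have -> : z' = last x (p ++ q) by rewrite last_cat pE.
apply: le_trans (path_sum_le_lpp y pq).
by rewrite -cat_cons big_cat /= lerDl sumr_ge0.
Qed.

(** Paths are split after their first step. As both neighbours lie below [z], no path is empty and
    neither supremum on the right takes its default value 0. *)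
Lemma lpp_recursion y x z : sle (x + e1) z -> sle (x + e2) z ->
  lpp y x z = y x + Num.max (lpp y (x + e1) z) (lpp y (x + e2) z).
Proof.
move=> h1 h2; apply/le_anti/andP; split.
  apply: lpp_le; first by case: h1 h2; rewrite /sle /=; lia.
  case=> [_ xE|u p /= /andP[xu pp] pE].
    by move: h1; rewrite -xE /sle /=; lia.
  rewrite big_cons lerD2l; have := path_sum_le_lpp y pp; rewrite pE => le_lpp.
  by case/orP: xu pp pE le_lpp => /eqP-> pp pE le_lpp; rewrite le_max le_lpp ?orbT.
rewrite -lerBrDl ge_max; apply/andP; split; apply: lpp_le => // p pp pE;
  rewrite lerBrDl.
  have pp' : path upright x (x + e1 :: p) by rewrite /= /upright eqxx.
  by have := path_sum_le_lpp y pp'; rewrite /= pE big_cons.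
have pp' : path upright x (x + e2 :: p) by rewrite /= /upright eqxx orbT.
by have := path_sum_le_lpp y pp'; rewrite /= pE big_cons.
Qed.

(** Subtraction turns the maximum of the recursion into a minimum. This is the form that passes to
    the limit in [z]. *)
Lemma min_sub_lpp y x z : sle (x + e1) z -> sle (x + e2) z ->
  Num.min (lpp y x z - lpp y (x + e1) z) (lpp y x z - lpp y (x + e2) z) = y x.
Proof.
move=> h1 h2; rewrite (lpp_recursion y h1 h2).
by have [] := leP (lpp y (x + e1) z) (lpp y (x + e2) z) => ?; case: leP; lra.
Qed.

(** The increments of [b] telescope along the path. The weight of the last site is charged to one
    extra [e1] step, whence [last x p + e1] and [(size p).+1]. *)
Lemma path_sum_le_cocycle y (b : site -> site -> R) (s : R) :
  (forall u v w, b u v + b v w = b u w) ->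
  (forall u, y u <= b u (u + e1) + s) -> (forall u, y u <= b u (u + e2) + s) ->
  forall x p, path upright x p ->
  \sum_(u <- x :: p) y u <= b x (last x p + e1) + (size p).+1%:R * s.
Proof.
move=> badd b1 b2 x p; elim: p x => [|u p IH] x /=.
  by rewrite big_seq1 mul1r.
case/andP=> xu /IH {}IH; rewrite big_cons -(badd x u).
rewrite [(size p).+2%:R]mulrS mulrDl mul1r addrACA lerD//.
by case/orP: xu => /eqP->.
Qed.

Lemma belast_sum_le y x p : (forall u, 0 <= y u) ->
  \sum_(u <- belast x p) y u <= \sum_(u <- x :: p) y u.
Proof. by move=> y0; rewrite lastI big_rcons /= lerDl. Qed.

Lemma pl_has_ubound y (h : R * R) (n : nat) : (forall u, 0 <= y u) -> has_ubound
  [set \sum_(u <- belast 0 p) y u + dotp h (site_vec (last 0 p)) | p in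
        [set p : seq site | path upright 0 p /\ size p = n]].
Proof.
move=> y0; exists (steps_bound y 0 n + (`|h.1| + `|h.2|) * n%:R) => _ [p [pp pn] <-].
apply: lerD.
  by apply: le_trans (belast_sum_le _ _ y0) _; rewrite -pn path_sum_le_bound.
have := upright_path_size pp; have := upright_path_le pp.
rewrite /sle /dotp /site_vec /=; case: (last 0 p) => i j /= [i0 j0].
rewrite pn !add0r => ijn.
have coord (c : R) (k : int) : 0 <= k -> k <= n%:Z -> c * k%:~R <= `|c| * n%:R.
  move=> k0 kn; apply: le_trans (ler_norm _) _.
  rewrite normrM ler_wpM2l// ger0_norm ?ler0z//.
  by rewrite -[leRHS]/(n%:Z%:~R) ler_int.
by rewrite mulrDl lerD// coord//; lia.
Qed.

(** Restoring the nonnegative weight at the end point only enlarges the sum; paths are then grouped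
    by end point. *)
Lemma pl_lpp_le y (h : R * R) (n : nat) (M : R) : (forall u, 0 <= y u) ->
  (forall i j : int, 0 <= i -> 0 <= j -> i + j = n%:Z ->
     lpp y 0 (i, j) + dotp h (i%:~R, j%:~R) <= M) ->
  pl_lpp y h n <= M.
Proof.
move=> y0 hM; apply: ge_sup => [|_ [p [pp pn] <-]].
  have [p pp pE] : exists2 p, path upright 0 p & last 0 p = (n%:Z, 0).
    by apply: upright_path_exists; split.
  exists (\sum_(u <- belast 0 p) y u + dotp h (site_vec (last 0 p))), p => //.
  by split=> //; have := upright_path_size pp; rewrite pE /=; lia.
have := upright_path_size pp; have := upright_path_le pp.
have := path_sum_le_lpp y pp; rewrite /sle /site_vec /= pn.
case: (last 0 p) => i j /= le_lpp [i0 j0] ij.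
apply: le_trans (hM i j i0 j0 _); last by lia.
by rewrite lerD2r; apply: le_trans (belast_sum_le _ _ y0) le_lpp.
Qed.

(* The weight at the end point of a path does not count in pl_lpp, hence the
   strict inequality. *)
Lemma pl_lpp_ge y (h : R * R) (i j : int) (n : nat) : (forall u, 0 <= y u) ->
  0 <= i -> 0 <= j -> i + j < n%:Z ->
  lpp y 0 (i, j) + dotp h ((n%:Z - j)%:~R, j%:~R) <= pl_lpp y h n.
Proof.
move=> y0 i0 j0 ijn; rewrite -lerBrDr; apply: lpp_le; first by split.
move=> p pp pE; rewrite lerBrDr.
(* The path is prolonged horizontally to level [n]. At least one step is added, so the weight at
   [(i, j)] is still counted. *)
have [|q qq qE] := @upright_path_exists ((i, j) + e1) (n%:Z - j, j).
  by split => /=; lia.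
have pq : path upright 0 (p ++ (i, j) + e1 :: q).
  by rewrite cat_path pp pE /= qq /upright eqxx.
have lq : last 0 (p ++ (i, j) + e1 :: q) = (n%:Z - j, j) by rewrite last_cat.
have sq : size (p ++ (i, j) + e1 :: q) = n.
  by have := upright_path_size pq; rewrite lq /=; lia.
have -> : dotp h ((n%:Z - j)%:~R, j%:~R) =
    dotp h (site_vec (last 0 (p ++ (i, j) + e1 :: q))) by rewrite lq.
apply: le_trans (ub_le_sup (pl_has_ubound h n y0) _); last first.
  by exists (p ++ (i, j) + e1 :: q).
rewrite lerD2r lastI belast_cat pE big_rcons big_cat lerD2l big_cons lerDl.
exact: sumr_ge0.
Qed.

End LastPassage.

(** * The exponential distribution *)

Section ExponentialLaw.
Context {d : measure_display} {Omega : measurableType d} {R : realType}.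
Variable P : probability Omega R.
Implicit Types (X : Omega -> R) (rate : R).

Lemma exp_dist_ge0_ae rate X : exp_dist P rate X -> {ae P, forall w, 0 <= X w}.
Proof.
move=> [mX XP]; exists (X @^-1` `]-oo, 0[); split.
- by rewrite -[_ @^-1` _]setTI; exact: mX.
- rewrite XP// /exponential_prob; apply: integral0_eq => t /=.
  by rewrite in_itv/= => t0; rewrite lt0_exponential_pdf.
- by move=> w /= /negP; rewrite -ltNge in_itv.
Qed.

Lemma exp_dist_gt rate X (t : R) : 0 < t -> exp_dist P rate X ->
  P (X @^-1` `]t, +oo[) = (expR (- rate * t))%:E.
Proof.
move=> t0 [mX XP].
have mXA (A : set R) : measurable A -> measurable (X @^-1` A).
  by move=> mA; rewrite -[_ @^-1` _]setTI; exact: mX.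
pose A0 := X @^-1` `]-oo, 0[; pose A1 := X @^-1` `[0, t].
have PA0 : P A0 = 0%E.
  rewrite XP// /exponential_prob; apply: integral0_eq => u /=.
  by rewrite in_itv/= => u0; rewrite lt0_exponential_pdf.
have PA1 : P A1 = (1 - (expR (- rate * t))%:E)%E.
  by rewrite XP// exponential_prob_itv0c.
have -> : X @^-1` `]t, +oo[ = ~` (A0 `|` A1).
  by apply/seteqP; split => w /=; rewrite /A0 /A1 /= !in_itv/= andbT; lra.
have mA0 : measurable A0 by exact: mXA.
have mA1 : measurable A1 by exact: mXA.
rewrite probability_setC; last exact: measurableU.
have -> : P (A0 `|` A1) = (P A0 + P A1)%E.
  apply: measureU => //.
  by apply/seteqP; split => w //=; rewrite /A0 /A1 /= !in_itv/=; lra.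
by rewrite PA0 PA1 add0e -!EFinB; congr EFin; lra.
Qed.

(** The mean is the integral of the tail [expR (- rate * t)], which is [rate^-1] times the density,
    of total mass 1. *)
Lemma exp_dist_expectation rate X : 0 < rate -> exp_dist P rate X ->
  'E_P[X]%E = (rate^-1)%:E.
Proof.
move=> rate0 hX; have [mX _] := hX.
(* The tail formula asks for nonnegativity everywhere, while [X] is nonnegative only almost
   surely. *)
pose Xp w := Num.max (X w) 0.
have mXp : measurable_fun setT Xp.
  by apply: measurable_maxr => //; exact: measurable_cst.
pose Xr : {RV P >-> R} := HB.pack Xp (isMeasurableFun.Build _ _ _ _ _ mXp).
transitivity ('E_P[Xr])%E.
  rewrite unlock; apply: ae_eq_integral => //; try exact/measurable_EFinP.
  by apply: filterS (exp_dist_ge0_ae hX) => w Xw0 _; rewrite /= /Xp max_l.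
rewrite ge0_expectation_ccdf; last by move=> w; rewrite le_max lexx orbT.
rewrite -integral_itv_obnd_cbnd; last first.
  by apply: measurable_funTS; exact: ccdf_measurable.
have pdf_ge0 t : (0 <= (exponential_pdf rate t)%:E)%E.
  by rewrite lee_fin exponential_pdf_ge0// ltW.
have mpdf D : measurable_fun D (EFin \o exponential_pdf rate).
  apply: measurable_funTS; apply/measurable_EFinP.
  exact: measurable_exponential_pdf.
transitivity (\int[lebesgue_measure]_(t in `]0%R, +oo[)
    ((rate^-1)%:E * (exponential_pdf rate t)%:E))%E.
  apply: eq_integral => t; rewrite inE /= in_itv/= andbT => t0.
  rewrite exponential_pdfE ?ltW// -EFinM mulKf ?gt_eqF// -(exp_dist_gt t0 hX).
  rewrite /ccdf /distribution /pushforward; congr (P _).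
  by apply/seteqP; split=> w /=; rewrite !in_itv/= !andbT /Xp lt_max; lra.
rewrite ge0_integralZl_EFin//; [|exact: mpdf|by rewrite invr_ge0 ltW].
rewrite integral_itv_obnd_cbnd; last exact: mpdf.
rewrite integral_mkcond.
rewrite (_ : _ \_ _ = EFin \o exponential_pdf rate); last first.
  apply/funext => t; rewrite patchE; case: ifPn => //.
  rewrite notin_setE /= in_itv/= andbT => /negP; rewrite -ltNge => t0.
  by rewrite lt0_exponential_pdf.
by rewrite integral_exponential_pdf// mule1.
Qed.

End ExponentialLaw.

(** * Almost sure properties and stationary cocycles *)

Section AlmostSure.
Context {d : measure_display} {Omega : measurableType d} {R : realType}.
Variable P : probability Omega R.
Implicit Types (theta : site -> Omega -> Omega) (Y : site -> Omega -> R).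
Implicit Types (B : Omega -> site -> site -> R) (h xi : R * R).

Lemma ae_witness (Q : Omega -> Prop) : {ae P, forall w, Q w} -> exists w, Q w.
Proof.
have P0 : (0 < P [set: Omega])%E by rewrite probability_setT.
have := ae_properfilter_algebraOfSetsType P0 => pf hQ.
exact: (@filter_ex _ _ pf _ hQ).
Qed.

Lemma as_lim_eq (u : nat -> Omega -> R) (c : R) :
  as_cvg P u c -> as_lim P u = c.
Proof.
move=> uc; apply: xget_unique => // c' uc'.
have [w [cw c'w]] : exists w, u n w @[n --> \oo] --> c /\ u n w @[n --> \oo] --> c'.
  by apply: ae_witness; apply: filterS2 uc uc' => w.
exact: (cvg_unique _ c'w cw).
Qed.

(** Sites are countable, so the exceptional null sets can be united. *)
Lemma ae_forall_site (Q : site -> Omega -> Prop) :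
  (forall x, {ae P, forall w, Q x w}) -> {ae P, forall w, forall x, Q x w}.
Proof.
move=> hQ.
have : {ae P, forall w, forall n x, unpickle n = Some x -> Q x w}.
  apply: ae_foralln => n; case: (unpickle n) => [x|]; last by apply: aeW.
  by apply: filterS (hQ x) => w Qw _ [<-].
by apply: filterS => w Qw x; apply: (Qw (pickle x)); rewrite pickleK.
Qed.

Lemma ae_preserved (phi : Omega -> Omega) (Q : Omega -> Prop) :
  measurable_fun setT phi ->
  (forall A, measurable A -> P (phi @^-1` A) = P A) ->
  {ae P, forall w, Q w} -> {ae P, forall w, Q (phi w)}.
Proof.
move=> mphi Pphi [N [mN PN sN]]; exists (phi @^-1` N); split.
- by rewrite -[_ @^-1` _]setTI; exact: mphi.
- by rewrite Pphi.
- by move=> w /= nQ; apply: sN.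
Qed.

(** For nonnegative functions this is the change of variables, the image of [P] being [P]; the
    general case splits into positive and negative parts. *)
Lemma integral_preserved (phi : Omega -> Omega) (f : Omega -> \bar R) :
  measurable_fun setT phi ->
  (forall A, measurable A -> P (phi @^-1` A) = P A) ->
  measurable_fun setT f ->
  (\int[P]_w f (phi w) = \int[P]_w f w)%E.
Proof.
move=> mphi Pphi mf.
have ge0_case (g : Omega -> \bar R) : measurable_fun setT g ->
    (forall w, 0 <= g w)%E -> (\int[P]_w g (phi w) = \int[P]_w g w)%E.
  move=> mg g0; rewrite -[LHS](@ge0_integral_pushforward _ _ _ _ _ phi mphi P setT g)//.
  by apply: eq_measure_integral => A mA _; exact: Pphi.
rewrite [LHS]integralE [RHS]integralE; congr (_ - _)%E.
  by rewrite -(ge0_case _ (measurable_funepos mf))//;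
    apply: eq_integral => w _; rewrite (funepos_comp f phi).
by rewrite -(ge0_case _ (measurable_funeneg mf))//;
    apply: eq_integral => w _; rewrite (funeneg_comp f phi).
Qed.

Lemma integral_cocycle_shift theta B x y z : pp_action P theta ->
  cocycleK P theta B ->
  (\int[P]_w (B w (x + z)%R (y + z)%R)%:E = \int[P]_w (B w x y)%:E)%E.
Proof.
move=> [_ _ mtheta Ptheta] [mB statB _ _].
rewrite -[RHS](integral_preserved (mtheta z) (Ptheta z)); last exact/measurable_EFinP.
apply: ae_eq_integral => //; [exact/measurable_EFinP| |].
  by apply/measurable_EFinP; apply: (measurableT_comp (mB x y)); exact: mtheta.
by apply: filterS statB => w sB _; rewrite sB.
Qed.

Lemma integral_cocycle_add theta B x y z : cocycleK P theta B ->
  (\int[P]_w (B w x z)%:E = \int[P]_w (B w x y)%:E + \int[P]_w (B w y z)%:E)%E.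
Proof.
move=> [mB _ addB intB]; rewrite -integralD//.
apply: ae_eq_integral => //; [exact/measurable_EFinP| |].
  by apply: emeasurable_funD; exact/measurable_EFinP.
by apply: filterS addB => w aB _; rewrite -EFinD aB.
Qed.

(** Additivity gives [n] increments, and each has the mean of [B w 0 e] by stationarity. *)
Lemma integral_cocycle_multiple theta B x (e : site) (n : nat) : pp_action P theta ->
  cocycleK P theta B ->
  (\int[P]_w (B w x (x + e *+ n)%R)%:E = n%:R%:E * \int[P]_w (B w 0%R e)%:E)%E.
Proof.
move=> htheta hB.
have finB u v : (\int[P]_w (B w u v)%:E)%E \is a fin_num.
  by apply: integrable_fin_num => //; exact: coc_int hB _ _.
elim: n => [|n IH].
  rewrite mul0e mulr0n addr0.
  (* The mean of [B w x x] is twice itself and finite, hence 0. *)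
  have := integral_cocycle_add x x x hB; rewrite -(fineK (finB x x)) -EFinD.
  by case=> /eqP; rewrite -subr_eq0 opprD addrA subrr sub0r oppr_eq0 => /eqP->.
rewrite (integral_cocycle_add x (x + e *+ n) _ hB) IH [e *+ n.+1]mulrSr [x + (_ + _)]addrA.
have := integral_cocycle_shift 0 e (x + e *+ n) htheta hB.
rewrite add0r [e + _]addrC => ->.
by rewrite -(fineK (finB 0 e)) -!EFinM -EFinD [n.+1%:R]mulrSr [in RHS]mulrDl mul1r.
Qed.

Lemma expectation_cocycle theta B (i j : nat) : pp_action P theta ->
  cocycleK P theta B ->
  (\int[P]_w (B w 0%R (i%:Z, j%:Z))%:E = (- dotp (hvec P B) (i%:R, j%:R))%:E)%E.
Proof.
move=> htheta hB.
have finB u v : (\int[P]_w (B w u v)%:E)%E \is a fin_num.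
  by apply: integrable_fin_num => //; exact: coc_int hB _ _.
rewrite (integral_cocycle_add 0 (0 + e1 *+ i) _ hB).
have -> : (i%:Z, j%:Z) = (0 + e1 *+ i) + e2 *+ j :> site.
  rewrite add0r; have -> : e1 *+ i = (i%:Z, 0).
    by elim: i => // i IH; rewrite mulrS IH; congr (_, _); lia.
  have -> : e2 *+ j = (0, j%:Z).
    by elim: j => // j IH; rewrite mulrS IH; congr (_, _); lia.
  by congr (_, _) => /=; lia.
rewrite !(integral_cocycle_multiple _ _ _ htheta hB) /hvec /dotp /= unlock.
rewrite -(fineK (finB 0 e1)) -(fineK (finB 0 e2)) -!EFinM -EFinD.
by congr EFin; ring.
Qed.
End AlmostSure.

(** * Convergence of the point-to-level values *)

Section Scaling.
Context {R : realType}.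
Implicit Types (y : site -> R) (h xi : R * R).

(** This is [pp_seq] at a fixed sample point, which keeps the scaling argument deterministic. *)
Definition scaled_lpp y xi (n : nat) : R :=
  n%:R^-1 * lpp y 0 (floor_vec (n%:R * xi.1, n%:R * xi.2)).

Lemma scaled_lppE y xi (n : nat) : (0 < n)%N ->
  lpp y 0 (floor_vec (n%:R * xi.1, n%:R * xi.2)) = n%:R * scaled_lpp y xi n.
Proof. by move=> n0; rewrite mulrA mulfV ?mul1r// pnatr_eq0 -lt0n. Qed.

(* Both coordinates are rounded up, so they sum to 1 + 1 / (K + 1). *)
Definition grid_dir (K k : nat) : R * R :=
  (k.+1%:R / K.+1%:R, (K.+1 - k)%:R / K.+1%:R).

(** With [k] the integer part of [(K + 1) i / n], rounding up moves each coordinate by at most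
    [n / (K + 1)]. *)
Lemma grid_dir_ge (K n i j : nat) : (0 < n)%N -> (i + j = n)%N ->
  exists2 k, (k < K.+2)%N &
  [/\ i%:R <= n%:R * (grid_dir K k).1, j%:R <= n%:R * (grid_dir K k).2,
      n%:R * ((grid_dir K k).1 - K.+1%:R^-1) <= i%:R &
      n%:R * ((grid_dir K k).2 - K.+1%:R^-1) <= j%:R].
Proof.
move=> n0 ijn; pose k := ((K.+1 * i) %/ n)%N.
have k1 : (k * n <= K.+1 * i)%N by exact: leq_divM.
have k2 : (K.+1 * i <= k.+1 * n)%N by rewrite ltnW// ltn_ceil.
have kK : (k <= K.+1)%N.
  by rewrite -(leq_pmul2r n0) (leq_trans k1)// leq_mul2l; lia.
have jE : j%:R = n%:R - i%:R :> R by rewrite -ijn natrD addrC addKr.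
have {}k1 : k%:R * n%:R <= K.+1%:R * i%:R :> R by rewrite -!natrM ler_nat.
have {}k2 : K.+1%:R * i%:R <= (k%:R + 1) * n%:R :> R.
  by rewrite natr1 -!natrM ler_nat.
exists k => //; rewrite /grid_dir /= natrB// jE -(natr1 k).
have K0 : 0 < K.+1%:R :> R by rewrite ltr0n.
have leq_divr (u v : R) : K.+1%:R * u <= v -> u <= v / K.+1%:R.
  by rewrite ler_pdivlMr// mulrC.
have geq_divr (u v : R) : v <= K.+1%:R * u -> v / K.+1%:R <= u.
  by rewrite ler_pdivrMr// mulrC.
have -> : (k%:R + 1) / K.+1%:R - K.+1%:R^-1 = k%:R / K.+1%:R :> R by ring.
have -> : (K.+1%:R - k%:R) / K.+1%:R - K.+1%:R^-1 =
    (K.+1%:R - k%:R - 1) / K.+1%:R :> R by ring.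
rewrite !mulrA; split; [apply: leq_divr|apply: leq_divr|apply: geq_divr|
  apply: geq_divr]; lra.
Qed.

Lemma pl_lpp_cvg0 y h xi (g : R * R -> R) :
  (forall u, 0 <= y u) -> h.1 <= 0 -> h.2 <= 0 ->
  0 <= xi.1 -> 0 <= xi.2 -> xi.1 + xi.2 = 1 ->
  (forall K k, scaled_lpp y (grid_dir K k) n @[n --> \oo] --> g (grid_dir K k)) ->
  (forall K k, g (grid_dir K k) <= - dotp h (grid_dir K k)) ->
  scaled_lpp y xi n @[n --> \oo] --> - dotp h xi ->
  n%:R^-1 * pl_lpp y h n @[n --> \oo] --> 0.
Proof.
move=> y0 h10 h20 xi10 xi20 xi1 cvg_grid g_le cvg_xi.
apply/cvgrPdist_le => e e0.
have e20 : 0 < e / 2 by rewrite divr_gt0.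
(* The grid is so fine that rounding an end point up changes the linear term by at most
   [n * (e / 2)]. *)
pose K := Num.truncn ((- h.1 - h.2) / (e / 2)).
have Ke : (- h.1 - h.2) / K.+1%:R <= e / 2.
  rewrite ler_pdivrMr ?ltr0n// mulrC -ler_pdivrMr//.
  by rewrite ltW// truncnS_gt.
(* There are finitely many grid directions, so one threshold in [n] serves all end points. *)
have upper : \forall n \near \oo, forall k : 'I_K.+2,
    scaled_lpp y (grid_dir K k) n <= g (grid_dir K k) + e / 2.
  apply: filter_forall => k.
  have /cvgrPdist_le/(_ _ e20) := cvg_grid K k.
  by apply: filterS => n; rewrite distrC ler_distl => /andP[].
have lower : \forall n \near \oo, - dotp h xi - e / 2 <= scaled_lpp y xi n.
  have /cvgrPdist_le/(_ _ e20) := cvg_xi.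
  by apply: filterS => n; rewrite distrC ler_distl => /andP[].
(* In the lower bound the end point has first coordinate below [m * xi.1 + 2]; the cost [- h.1 * 2]
   is absorbed here. *)
have large : \forall n \near \oo, (- h.1 * 2) / (e / 2) <= n%:R :> R.
  exact: nbhs_infty_ger.
case: upper => N1 _ upper; case: lower => N2 _ lower; case: large => N3 _ large.
exists (N1 + N2 + N3 + 2)%N => // n /= nN.
have [n_gt0 N1n N3n] : [/\ (0 < n)%N, (N1 <= n)%N & (N3 <= n)%N].
  by clear -nN; split; lia.
have n0 : 0 < n%:R :> R by rewrite ltr0n.
rewrite sub0r normrN ler_norml; apply/andP; split.
  rewrite mulrC ler_pdivlMr// mulNr.
  (* The floors of [m * xi] sum to at most [m = n - 1], as the strict inequality in [pl_lpp_ge]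
     requires. *)
  have [m nE] : exists m, n = m.+1 by exists n.-1; rewrite prednK.
  have [m_gt0 N2m] : (0 < m)%N /\ (N2 <= m)%N by clear -nN nE; split; lia.
  pose i := Num.floor (m%:R * xi.1); pose j := Num.floor (m%:R * xi.2).
  have i0 : 0 <= i by rewrite floor_ge0 mulr_ge0.
  have j0 : 0 <= j by rewrite floor_ge0 mulr_ge0.
  have il : i%:~R <= m%:R * xi.1 by exact: floor_le.
  have jl : j%:~R <= m%:R * xi.2 by exact: floor_le.
  have jg : m%:R * xi.2 < (j + 1)%:~R by exact: floorD1_gt.
  have ijn : i + j < n%:Z.
    have -> : n%:Z = m%:Z + 1 by rewrite nE -addn1 PoszD.
    rewrite ltzD1 -(ler_int R) intrD; apply: le_trans (lerD il jl) _.
    by rewrite -mulrDr xi1 mulr1.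
  apply: le_trans (pl_lpp_ge h y0 i0 j0 ijn).
    have lppE : lpp y 0 (i, j) = m%:R * scaled_lpp y xi m by rewrite -scaled_lppE.
  clearbody i j.
  have := lower m N2m; have := large n N3n; rewrite /= ler_pdivrMr// lppE /dotp /=.
  rewrite intrB -pmulrn.
  rewrite intrD in jg; have nE' : n%:R = m%:R + 1 :> R by rewrite nE natr1.
  have m0 : 0 <= m%:R :> R by [].
  set M := m%:R in m0 nE' il jl jg *; set J := j%:~R in jl jg *.
  set S := scaled_lpp _ _ _; rewrite !nE' => large1 lower1.
    have h1J : h.1 * (M * xi.1 + 2) <= h.1 * (M + 1 - J).
    by rewrite ler_wnM2l//; have := congr1 ( *%R M) xi1; rewrite mulrDr mulr1; lra.
  have h2J : h.2 * (M * xi.2) <= h.2 * J by rewrite ler_wnM2l.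
  have := ler_wpM2l m0 lower1.
  clear -h1J h2J large1 m0 e0; nra.
rewrite mulrC ler_pdivrMr//; apply: pl_lpp_le => //.
move=> [i|//] [j|//] _ _ [] ijn.
have [k kK [ik jk ik' jk']] := grid_dir_ge K n_gt0 ijn.
have grid1 : 0 <= n%:R * (grid_dir K k).1 by exact: le_trans ik.
have grid2 : 0 <= n%:R * (grid_dir K k).2 by exact: le_trans jk.
have le_lpp : lpp y 0 (Posz i, Posz j) <= n%:R * (g (grid_dir K k) + e / 2).
  apply: le_trans (_ : _ <= n%:R * scaled_lpp y (grid_dir K k) n) _; last first.
    by rewrite ler_wpM2l// (upper n N1n (Ordinal kK)).
  rewrite -scaled_lppE//; apply: lpp_monotone => //.
  by split; rewrite /= floor_ge_int.
apply: le_trans (lerD le_lpp (lexx _)) _.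
have := g_le K k; move: Ke ik' jk'; rewrite /dotp /= -!pmulrn.
move: (g _) (k.+1%:R / _) ((K.+1 - k)%:R / _) => G u v.
move: K.+1%:R^-1 => c Ke ui vj Guv.
(* Since [h] has nonpositive coordinates, lower bounds on the end point bound the linear term from
   above. *)
have h1i := ler_wnM2l h10 ui; have h2j := ler_wnM2l h20 vj.
have := ler_wpM2l (ltW n0) Ke; have := ler_wpM2l (ltW n0) Guv.
move: (n%:R) (i%:R) (j%:R) h1i h2j => N I J; clear; lra.
Qed.

End Scaling.

(** * Limits along a direction *)

Section Directions.
Context {R : realType}.
Implicit Types (y : site -> R) (xi : R * R).

Lemma cvg_minr (u v : nat -> R) (a b : R) :
  u n @[n --> \oo] --> a -> v n @[n --> \oo] --> b ->
  Num.min (u n) (v n) @[n --> \oo] --> Num.min a b.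
Proof.
move=> ua vb; rewrite minr_absE; under eq_cvg do rewrite minr_absE.
apply: cvgMl; apply: cvgB; first exact: cvgD.
by apply: cvg_norm; exact: cvgB.
Qed.

Lemma cvg_floor_scaled (x : R) :
  n%:R^-1 * (Num.floor (n%:R * x))%:~R @[n --> \oo] --> x.
Proof.
apply/cvgrPdist_le => e e0.
have large : \forall n \near \oo, e^-1 <= n%:R :> R by exact: nbhs_infty_ger.
near=> n.
have en : e^-1 <= n%:R by near: n.
have n0 : 0 < n%:R :> R by rewrite (lt_le_trans _ en)// invr_gt0.
have := floor_le (n%:R * x); have := floorD1_gt (n%:R * x); rewrite intrD.
move: (Num.floor _)%:~R => f fgt fle.
have -> : x - n%:R^-1 * f = (n%:R * x - f) / n%:R by field; rewrite gt_eqF.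
rewrite normrM normfV (gtr0_norm n0) ger0_norm; last by lra.
rewrite ler_pdivrMr//; apply: (@le_trans _ _ 1); first by lra.
by rewrite -[leLHS](mulfV (lt0r_neq0 e0)) ler_pM2l.
Unshelve. all: by end_near. Qed.

Lemma floor_vec_ge0 xi (n : nat) : 0 <= xi.1 -> 0 <= xi.2 ->
  sle 0 (floor_vec (n%:R * xi.1, n%:R * xi.2)).
Proof. by move=> x1 x2; split; rewrite /= floor_ge0 mulr_ge0. Qed.

(** As the coordinates of [xi] sum to 1, the norm of the floor vector is asymptotic to [n], and one
    may normalize by either. *)
Lemma floor_vec_in_direction xi : 0 <= xi.1 -> 0 <= xi.2 -> xi.1 + xi.2 = 1 ->
  in_direction (fun n => floor_vec (n%:R * xi.1, n%:R * xi.2)) xi.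
Proof.
move=> x1 x2 x12; pose v n := floor_vec (n%:R * xi.1, n%:R * xi.2).
have v0 n : sle 0 (v n) by exact: floor_vec_ge0.
have normE n : (norm1 (v n))%:R = (v n).1%:~R + (v n).2%:~R :> R.
  by rewrite /norm1 natrD !natr_absz !ger0_norm; case: (v0 n).
have c1 : n%:R^-1 * (v n).1%:~R @[n --> \oo] --> xi.1 by exact: cvg_floor_scaled.
have c2 : n%:R^-1 * (v n).2%:~R @[n --> \oo] --> xi.2 by exact: cvg_floor_scaled.
have cvg1 : n%:R^-1 * (norm1 (v n))%:R @[n --> \oo] --> (1 : R).
  under eq_cvg do rewrite normE mulrDr.
  by have := cvgD c1 c2; rewrite x12 => c12; exact: c12.
have ratio (u : nat -> R) (x : R) : n%:R^-1 * u n @[n --> \oo] --> x ->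
    u n / (norm1 (v n))%:R @[n --> \oo] --> x.
  move=> ux.
  have : (n%:R^-1 * u n) * (n%:R^-1 * (norm1 (v n))%:R)^-1 @[n --> \oo] --> x.
    have := cvgM ux (cvgV (oner_neq0 R) cvg1).
    by rewrite invr1 mulr1 => ux1; exact: ux1.
  apply: cvg_trans; apply: near_eq_cvg; near=> n.
  have n0 : n%:R != 0 :> R.
    by rewrite pnatr_eq0 -lt0n; near: n; exact: nbhs_infty_gt.
  by rewrite /= invfM invrK mulrACA mulVf ?mul1r.
split; [|exact: ratio|exact: ratio].
apply/cvgnyPge => A; near=> n.
(* Each of the two floors loses less than 1. *)
have An : (A + 2 <= n)%N by near: n; exact: nbhs_infty_ge.
rewrite -(ler_nat R) normE.
have := floorD1_gt (n%:R * xi.1); have := floorD1_gt (n%:R * xi.2).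
rewrite !intrD; have : (A + 2)%:R <= n%:R :> R by rewrite ler_nat.
have : n%:R * xi.1 + n%:R * xi.2 = n%:R :> R by rewrite -mulrDr x12 mulr1.
rewrite natrD /v /=; lra.
Unshelve. all: by end_near. Qed.

Lemma floor_vec_eventually_ge xi (z : site) : 0 < xi.1 -> 0 < xi.2 ->
  \forall n \near \oo, sle z (floor_vec (n%:R * xi.1, n%:R * xi.2)).
Proof.
move=> x1 x2; near=> n; split; rewrite /= floor_ge_int -ler_pdivrMr//;
  near: n; exact: nbhs_infty_ger.
Unshelve. all: by end_near. Qed.

(** Along [v] the minimum of the two differences is eventually the constant [y x], and the minimum
    is continuous. *)
Lemma min_busemann_limits y x (v : nat -> site) (b1 b2 : R) :
  (\forall n \near \oo, sle (x + e1) (v n)) ->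
  (\forall n \near \oo, sle (x + e2) (v n)) ->
  lpp y x (v n) - lpp y (x + e1) (v n) @[n --> \oo] --> b1 ->
  lpp y x (v n) - lpp y (x + e2) (v n) @[n --> \oo] --> b2 ->
  Num.min b1 b2 = y x.
Proof.
move=> v1 v2 lim1 lim2; apply: (cvg_unique _ (cvg_minr lim1 lim2)) => //.
apply: cvg_near_cst.
by apply: filterS2 v1 v2 => n v1n v2n; rewrite min_sub_lpp.
Qed.

End Directions.

(** * The variational bound *)

Lemma le_limn_einf {R : realType} (u v : nat -> \bar R) :
  (forall n, (u n <= v n)%E) -> (limn_einf u <= limn_einf v)%E.
Proof.
move=> uv; rewrite !limn_einf_lim; apply: lee_lim; try exact: is_cvg_einfs.
apply: nearW => n; apply: le_ereal_inf_tmp => _ [k nk <-].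
by apply: le_trans (uv k); apply: ereal_inf_lbound; exists k.
Qed.

Section VariationalBound.
Context {d : measure_display} {Omega : measurableType d} {R : realType}.
Variable P : probability Omega R.
Implicit Types (theta : site -> Omega -> Omega) (Y : site -> Omega -> R).
Implicit Types (B : Omega -> site -> site -> R) (h xi : R * R).

Lemma shape_le_var_obj_bound theta Y B xi (g c : R) :
  pp_action P theta -> (forall x w, Y x w = Y 0 (theta x w)) ->
  {ae P, forall w, forall x, 0 <= Y x w} ->
  0 <= xi.1 -> 0 <= xi.2 -> xi.1 + xi.2 = 1 ->
  0 <= g -> as_cvg P (pp_seq Y xi) g ->
  cocycleK P theta B -> {ae P, forall w, var_obj P Y B xi w <= c} -> g <= c.
Proof.
move=> htheta hYtheta Y0 xi1 xi2 xi12 g0 cvg_g hB objc.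
have PT : P [set: Omega] = 1%E by exact: probability_setT.
(* The bound [c] on the objective says that the weight minus each cocycle increment is at most
   [s]. *)
pose h := hvec P B; pose s := c + dotp h xi.
have Ystep : {ae P, forall w, forall x,
    Y x w <= B w x (x + e1) + s /\ Y x w <= B w x (x + e2) + s}.
  (* The shifts preserve [P] and carry the bound from the origin to every site. *)
  have objx : {ae P, forall w, forall x, var_obj P Y B xi (theta x w) <= c}.
    apply: ae_forall_site => x; apply: ae_preserved objc.
      exact: ppa_meas htheta x.
    exact: ppa_pres htheta x.
  apply: filterS2 objx (coc_stat hB) => w objw statw x.
  have := objw x; rewrite /var_obj ge_max -!hYtheta -!statw add0r.
  by rewrite ![_ + x]addrC -/h /s => /andP[]; split; lra.
pose i N := absz (Num.floor (N%:R * xi.1)).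
pose j N := absz (Num.floor (N%:R * xi.2)).
have vE N : floor_vec (N%:R * xi.1, N%:R * xi.2) = (Posz (i N), Posz (j N)).
  by rewrite /floor_vec /= !gez0_abs// floor_ge0 mulr_ge0.
(* A path to the floor vector visits [i N + j N + 1] sites; the cocycle ends one [e1] step
   further. *)
pose F N w := N%:R^-1 * (B w 0 (Posz (i N).+1, Posz (j N)) + (i N + j N).+1%:R * s).
have ppF : {ae P, forall w, forall N, 0 <= pp_seq Y xi N w <= F N w}.
  apply: filterS3 Y0 Ystep (coc_add hB) => w Y0w Yw addw N.
  rewrite /pp_seq vE; apply/andP; split.
    by rewrite mulr_ge0 ?invr_ge0//; apply: lpp_ge0.
  rewrite ler_wpM2l ?invr_ge0//; apply: lpp_le; first by split.
  move=> p pp pE; have := upright_path_size pp; rewrite pE /= => sp.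
  have sp' : size p = (i N + j N)%N by lia.
  have := path_sum_le_cocycle addw (fun x => (Yw x).1) (fun x => (Yw x).2) pp.
  by rewrite pE sp' [(_, _) + e1](_ : _ = (Posz (i N).+1, Posz (j N)))//;
    congr (_, _); rewrite /=; lia.
have mF N : measurable_fun setT (F N).
  apply: measurable_funM => //; apply: measurable_funD => //.
  exact: coc_meas hB _ _.
(* Fatou's lemma is applied to the truncation, as [F N] is nonnegative only almost surely; the
   integral is unchanged. *)
have mmaxF N : measurable_fun setT (fun w => (Num.max (F N w) 0)%:E).
  by apply/measurable_EFinP; apply: measurable_maxr.
pose EF N : R := N%:R^-1 * (- dotp h ((i N).+1%:R, (j N)%:R) + (i N + j N).+1%:R * s).
have intF N : (\int[P]_w (Num.max (F N w) 0)%:E = (EF N)%:E)%E.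
  transitivity (\int[P]_w (F N w)%:E)%E.
    apply: ae_eq_integral => //; last first.
    - apply: filterS ppF => w /(_ N)/andP[pp0 /(le_trans pp0) FN0] _.
      by rewrite max_l.
    - exact/measurable_EFinP.
  under eq_integral do rewrite EFinM EFinD.
  have intB := coc_int hB 0 (Posz (i N).+1, Posz (j N)).
  have intC : P.-integrable setT (cst ((i N + j N).+1%:R * s)%:E).
    exact: finite_measure_integrable_cst.
  rewrite integralZl//; last exact: integrableD.
  rewrite integralD// (expectation_cocycle _ _ htheta hB) integral_cst//.
  by rewrite [X in (_ * (_ + _ * X))%E]PT mule1 -EFinD -EFinM.
have cvgEF : (EF N)%:E @[N --> \oo] --> c%:E.
  have invN : N%:R^-1 @[N --> \oo] --> (0 : R).
    apply/cvgrPdist_le => e e0; near=> N.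
    rewrite sub0r normrN ger0_norm ?invr_ge0//.
    rewrite invf_ple ?posrE// ?ltr0n; near: N; first exact: nbhs_infty_ger.
    exact: nbhs_infty_gt.
  have cvgi : N%:R^-1 * (i N)%:R @[N --> \oo] --> xi.1.
    under eq_cvg do rewrite natr_absz ger0_norm ?floor_ge0 ?mulr_ge0//.
    exact: cvg_floor_scaled.
  have cvgj : N%:R^-1 * (j N)%:R @[N --> \oo] --> xi.2.
    under eq_cvg do rewrite natr_absz ger0_norm ?floor_ge0 ?mulr_ge0//.
    exact: cvg_floor_scaled.
  apply: cvg_EFin; first exact: nearW.
  have -> : fine \o (fun N => (EF N)%:E) = fun N =>
      - (h.1 * (N%:R^-1 * (i N)%:R + N%:R^-1) + h.2 * (N%:R^-1 * (j N)%:R)) +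
      (N%:R^-1 * (i N)%:R + N%:R^-1 * (j N)%:R + N%:R^-1) * s.
    apply/funext => N; rewrite /= /EF /dotp /= -!natr1 natrD; ring.
  (* As [xi.1 + xi.2 = 1], the linear terms in [h] cancel and leave [c]. *)
  have -> : c = - (h.1 * (xi.1 + 0) + h.2 * xi.2) + (xi.1 + xi.2 + 0) * s.
    by rewrite !addr0 xi12 mul1r /s /dotp; ring.
  apply: cvgD; first apply: cvgN; [apply: cvgD|apply: cvgMl].
  - by apply: cvgMr; exact: cvgD.
  - exact: cvgMr.
  - by apply: cvgD; first exact: cvgD.
have liminf_ge : {ae P, forall w, [set: Omega] w ->
    (g%:E <= limn_einf (fun N => (Num.max (F N w) 0)%:E))%E}.
  apply: filterS2 cvg_g ppF => w cvgw ppFw _.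
  have cvgEw : (pp_seq Y xi n w)%:E @[n --> \oo] --> g%:E.
    by apply: cvg_EFin; [exact: nearW|exact: cvgw].
  have [<- _] := cvg_limn_einf_sup cvgEw.
  apply: le_limn_einf => n; rewrite lee_fin le_max.
  by have /andP[_ ->] := ppFw n.
rewrite -lee_fin.
have <- : (\int[P]_w (cst g%:E w) = g%:E)%E.
  by rewrite integral_cst// [X in (_ * X)%E]PT mule1.
apply: (@le_trans _ _ (\int[P]_w (limn_einf (fun N => (Num.max (F N w) 0)%:E)))%E).
  apply: ae_ge0_le_integral => //.
  - move=> w _.
    have [lim0 _] := cvg_limn_einf_sup (@cvg_cst _ (0%E : \bar R) _ \oo _).
    rewrite -[leLHS]lim0; apply: le_limn_einf => n.
    by rewrite lee_fin le_max lexx orbT.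
  - apply: measurableT_comp => //; apply: measurable_fun_limn_esup => n.
    exact/measurableT_comp/mmaxF.
apply: le_trans (fatou _ _ _ _) _ => //.
- by move=> n w _; rewrite lee_fin le_max lexx orbT.
under [X in limn_einf X]eq_fun do rewrite intF.
by have [-> _] := cvg_limn_einf_sup cvgEF.
Unshelve. all: by end_near. Qed.

End VariationalBound.

(** * The characteristic direction *)

(** At [+oo] there is nothing to prove, and [-oo] is excluded by the upper bound [g - 1]. Essential
    suprema can thus be handled through real bounds. *)
Lemma lee_of_fin_ub {R : realType} (g : R) (x : \bar R) :
  (forall c : R, (x <= c%:E)%E -> g <= c) -> (g%:E <= x)%E.
Proof.
case: x => [c|_|hg]; rewrite ?leey//; first by move=> hg; rewrite lee_fin hg.
have : g <= g - 1 by apply: hg; rewrite leNye.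
by move=> ?; exfalso; lra.
Qed.

Section CharacteristicDirection.
Context {R : realType}.
Implicit Types (a : R) (xi : R * R).

Definition pp_shape xi : R := (Num.sqrt xi.1 + Num.sqrt xi.2) ^+ 2.

(** The value of h(B): minus the means of exponential variables of rates [1 - a] and [a]. *)
Definition dual_vec a : R * R := (- (1 - a)^-1, - a^-1).

Lemma char_dir_den_gt0 a : 0 < a -> 0 < (1 - a) ^+ 2 + a ^+ 2.
Proof. by move=> a0; rewrite ltr_wpDl ?sqr_ge0 ?exprn_gt0. Qed.

Lemma char_dir_gt0 a : 0 < a -> a < 1 ->
  0 < (char_dir a).1 /\ 0 < (char_dir a).2.
Proof.
move=> a0 a1; have D0 := char_dir_den_gt0 a0.
by split; rewrite divr_gt0 ?exprn_gt0// subr_gt0.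
Qed.

Lemma char_dir_sum a : 0 < a -> (char_dir a).1 + (char_dir a).2 = 1.
Proof. by move=> a0; rewrite -mulrDl divff// gt_eqF// char_dir_den_gt0. Qed.

(** The square roots of the coordinates are proportional to [1 - a] and [a], and both sides equal
    the inverse of the common denominator. *)
Lemma pp_shape_char_dir a : 0 < a -> a < 1 ->
  pp_shape (char_dir a) = - dotp (dual_vec a) (char_dir a).
Proof.
move=> a0 a1; have D0 := char_dir_den_gt0 a0.
rewrite /pp_shape /dotp /char_dir /dual_vec /=; set D := _ + _ in D0 *.
have sqD := sqr_sqrtr (ltW D0).
rewrite (sqrtrM _ (sqr_ge0 (1 - a))) (sqrtrM _ (sqr_ge0 a)).
rewrite !sqrtr_sqr !ger0_norm ?subr_ge0 ?ltW//.
rewrite -mulrDl subrK mul1r sqrtrV ?ltW// exprVn sqD.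
by field; rewrite !gt_eqF ?subr_gt0.
Qed.

(* Cauchy-Schwarz: [s^2/(1-a) + t^2/a - (s+t)^2 = (a s - (1-a) t)^2 / (a(1-a))] *)
Lemma pp_shape_le_dual a xi : 0 < a -> a < 1 -> 0 <= xi.1 -> 0 <= xi.2 ->
  pp_shape xi <= - dotp (dual_vec a) xi.
Proof.
move=> a0 a1 x1 x2; rewrite /pp_shape /dotp /dual_vec /=.
rewrite -{2}(sqr_sqrtr x1) -{2}(sqr_sqrtr x2).
move: (Num.sqrt _) (Num.sqrt _) => t s; rewrite -subr_ge0.
have b0 : 0 < 1 - a by rewrite subr_gt0.
rewrite (_ : _ - _ = (a * s - (1 - a) * t) ^+ 2 / (a * (1 - a))); last first.
  by field; rewrite !gt_eqF.
by rewrite divr_ge0 ?sqr_ge0// mulr_ge0// ltW.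
Qed.

End CharacteristicDirection.

(** * Busemann increments, the point-to-level limit, and the variational formula *)

Section Busemann.
Context {d : measure_display} {Omega : measurableType d} {R : realType}.
Variable P : probability Omega R.
Implicit Types (theta : site -> Omega -> Omega) (Y : site -> Omega -> R).
Implicit Types (B : Omega -> site -> site -> R) (h xi : R * R).

(** Both coordinates of the characteristic direction are positive, so its floor vectors eventually
    dominate [e1] and [e2] and the recursion applies. *)
Lemma busemann_min theta Y a B : 0 < a -> a < 1 -> busemann P theta Y a B ->
  {ae P, forall w, Num.min (B w 0 e1) (B w 0 e2) = Y 0 w}.
Proof.
move=> a0 a1 [_]; apply: filterS => w limB.
have [x1 x2] := char_dir_gt0 a0 a1.
have /limB {}limB := floor_vec_in_direction (ltW x1) (ltW x2) (char_dir_sum a0).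
rewrite -[e1]add0r -[e2]add0r.
apply: (min_busemann_limits (y := Y^~ w)
  (floor_vec_eventually_ge _ x1 x2) (floor_vec_eventually_ge _ x1 x2)); exact: limB.
Qed.

Lemma gpl_dual_vec Y a : 0 < a -> a < 1 ->
  {ae P, forall w, forall x, 0 <= Y x w} -> shape_theorem P Y ->
  as_cvg P (pl_seq Y (dual_vec a)) 0.
Proof.
move=> a0 a1 Y0 hshape; have [x1 x2] := char_dir_gt0 a0 a1.
have grid0 K k : 0 <= (grid_dir K k).1 :> R /\ 0 <= (grid_dir K k).2 :> R.
  by split; rewrite divr_ge0.
(* The grid directions are countable, so the shape theorem holds in all of them off one null set. *)
have cvg_grid : {ae P, forall w, forall K k,
    scaled_lpp (Y^~ w) (grid_dir K k) n @[n --> \oo] --> pp_shape (grid_dir K k)}.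
  apply: ae_foralln => K; apply: ae_foralln => k.
  by apply: hshape; case: (grid0 K k).
apply: filterS3 Y0 cvg_grid (hshape _ (ltW x1) (ltW x2)) => w Y0w cvgw cvgx.
apply: (pl_lpp_cvg0 (g := pp_shape) Y0w _ _ (ltW x1) (ltW x2) (char_dir_sum a0) cvgw).
- by rewrite oppr_le0 invr_ge0 subr_ge0 ltW.
- by rewrite oppr_le0 invr_ge0 ltW.
- by move=> K k; case: (grid0 K k) => *; exact: pp_shape_le_dual.
- by rewrite -pp_shape_char_dir.
Qed.

End Busemann.

Theorem theorem4p5 (d : measure_display) (Omega : measurableType d)
    (R : realType) (P : probability Omega R)
    (theta : site -> Omega -> Omega) (Y : site -> Omega -> R)
    (htheta : pp_action P theta)
    (hY : iid_exp1 P Y)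
    (hYtheta : forall x w, Y x w = Y 0 (theta x w))
    (hshape : shape_theorem P Y)
    (a : R) (ha0 : 0 < a) (ha1 : a < 1)
    (B : Omega -> site -> site -> R)
    (hB : busemann P theta Y a B)
    (hB1 : forall x, exp_dist P (1 - a) (fun w => B w x (x + e1)))
    (hB2 : forall x, exp_dist P a (fun w => B w x (x + e2))) :
  let xi := char_dir a in
  let h := hvec P B in
  [/\ as_cvg P (pl_seq Y h) (gpl P Y h) /\
      gpl P Y h = gpp P Y xi + dotp h xi,
      gpp P Y xi = - dotp h xi /\
      {ae P, forall w, - dotp h xi =
         Num.max (Y 0 w - B w 0 e1 - dotp h xi) (Y 0 w - B w 0 e2 - dotp h xi)}
    & var_sup P Y B xi = (gpp P Y xi)%:E /\
      (gpp P Y xi)%:E =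
        ereal_inf [set var_sup P Y B' xi | B' in [set B' | cocycleK P theta B']]].
Proof.
move=> xi h.
have [x1 x2] := char_dir_gt0 ha0 ha1.
have P0 : (0 < P [set: Omega])%E by rewrite probability_setT.
have Y0 : {ae P, forall w, forall x, 0 <= Y x w}.
  by apply: ae_forall_site => x; exact: exp_dist_ge0_ae (hY.2 x).
have hE : h = dual_vec a.
  rewrite /h /hvec /dual_vec.
  have b0 : 0 < 1 - a by rewrite subr_gt0.
  have := exp_dist_expectation b0 (hB1 0); rewrite add0r => ->.
  by have := exp_dist_expectation ha0 (hB2 0); rewrite add0r => ->.
have cvgpp : as_cvg P (pp_seq Y xi) (pp_shape xi) by apply: hshape; exact: ltW.
have gppE : gpp P Y xi = - dotp h xi.
  by rewrite /gpp (as_lim_eq cvgpp) hE pp_shape_char_dir.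
have cvgpl : as_cvg P (pl_seq Y h) 0 by rewrite hE; exact: gpl_dual_vec.
have maxE : {ae P, forall w, - dotp h xi =
    Num.max (Y 0 w - B w 0 e1 - dotp h xi) (Y 0 w - B w 0 e2 - dotp h xi)}.
  (* The larger of the two differences is the weight minus the smaller increment, which is 0. *)
  apply: filterS (busemann_min ha0 ha1 hB) => w; set s := dotp h xi.
  by case: leP => ? <-; case: leP; lra.
have supE : var_sup P Y B xi = (gpp P Y xi)%:E.
  apply: ess_sup_ae_cst => //; apply: filterS maxE => w.
  by rewrite gppE /var_obj /= => <-.
split; [split|split|split] => //.
- by rewrite /gpl (as_lim_eq cvgpl).
- by rewrite /gpl (as_lim_eq cvgpl) gppE addNr.
(* The Busemann function is itself a competitor and attains the value; the other inequality is the
   Fatou bound for an arbitrary cocycle. *)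
apply/le_anti/andP; split; last first.
  by apply: ereal_inf_lbound; exists B => //; exact: hB.1.
apply: le_ereal_inf_tmp => _ [B' hB' <-]; apply: lee_of_fin_ub => c.
move=> /ess_supP objc; rewrite gppE hE -pp_shape_char_dir//.
apply: (shape_le_var_obj_bound htheta hYtheta Y0 (ltW x1) (ltW x2)
  (char_dir_sum ha0) _ cvgpp hB').
  exact: sqr_ge0.
by apply: filterS objc => w; rewrite lee_fin.
Qed.
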